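(* Let $E$ be a metrizable, locally compact, $\sigma$-compact topological space with Borel $\sigma$-algebra $\mathcal{E}$. Let $(\Omega,\Sigma,\mathbb{P})$ be a probability space with a filtration $(\mathcal{F}_t)_{t\in[0,\infty]}$ (each $\mathcal{F}_t\subset\Sigma$), and let $(B_t)_{t\ge 0}$ be an $E$-valued Markov process on $\Omega$, adapted to $(\mathcal{F}_t)_{t\in[0,\infty]}$, with Feller semigroup $(Q_t)_{t\ge 0}$ on $C(E)$. Suppose additionally that $t\mapsto Q_t$ is continuous with respect to the operator norm topology on the space of bounded linear operators on $C(E)$. Set $\mathcal{F}_t^+ := \bigcap_{s>t}\mathcal{F}_s$ and $\widetilde{\mathcal{F}}_t := \sigma(\mathcal{F}_t^+\cup\mathcal{N})$, where $\mathcal{N}$ is the class of all $\mathcal{F}_\infty$-measurable sets with zero probability. Then $(B_t)_{t\ge 0}$ has a càdlàg modification $(\widetilde{B}_t)_{t\ge 0}$ which is adapted to the filtration $(\widetilde{\mathcal{F}}_t)_{t\ge 0}$. Moreover, $(\widetilde{B}_t)_{t\ge 0}$ is a Markov process with semigroup $(Q_t)_{t\ge 0}$ with respect to the filtration $(\widetilde{\mathcal{F}}_t)_{t\ge 0}$.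
   Context: $C(E)$ is the Banach space of bounded continuous functions $E\to\mathbb{R}$ with the supremum norm. A filtration $(\mathcal{F}_t)_{t\in[0,\infty]}$ is an increasing family of $\sigma$-algebras, with $\mathcal{F}_t\subset\mathcal{F}_\infty$ for all $t\ge0$. A transition kernel on $E$ is a map $Q:E\times\mathcal{E}\to[0,1]$ such that $Q(x,\cdot)$ is a probability measure for each $x\in E$ and $Q(\cdot,A)$ is measurable for each $A\in\mathcal{E}$; for $f$ bounded measurable, $Qf(x)=\int_E Q(x,\mathrm{d}y)f(y)$. A transition semigroup is a family $(Q_t)_{t\ge0}$ of transition kernels with (a) $Q_0(x,\cdot)=\delta_x$; (b) $Q_{s+t}(x,A)=\int_E Q_t(x,\mathrm{d}y)Q_s(y,A)$ for all $s,t\ge 0$; (c) $(t,x)\mapsto Q_t(x,A)$ is $\mathcal{B}([0,\infty))\otimes\mathcal{E}$-measurable for every $A\in\mathcal{E}$. It is a Feller semigroup on $C(E)$ if for all $f\in C(E)$: $Q_tf\in C(E)$ for all $t\ge 0$, and $\lVert Q_tf-f\rVert_{C(E)}\to0$ as $t\to0$. An $E$-valued process $(X_t)_{t\ge0}$ adapted to a filtration $(\mathcal{G}_t)_{t\ge 0}$ is a Markov process with semigroup $(Q_t)_{t\ge0}$ (with respect to that filtration) if for all $s,t\ge0$ and all bounded measurable $f:E\to\mathbb{R}$, $\mathbb{E}[f(X_{s+t})\mid X_s]=\mathbb{E}[f(X_{s+t})\mid\mathcal{G}_s]=Q_tf(X_s)$ almost surely. A modification of $(B_t)_{t\ge0}$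 is a process $(\widetilde B_t)_{t\ge0}$ on the same probability space with $B_t=\widetilde B_t$ almost surely for each $t\ge 0$. A process is càdlàg if for every $\omega\in\Omega$ the path $t\mapsto X_t(\omega)$ is right-continuous with left limits. *)

(* Defs.v *)
From HB Require Import structures.
From mathcomp Require Import all_boot all_order all_algebra.
From mathcomp Require Import all_classical all_reals all_analysis measurable_realfun.

Set Implicit Arguments.
Unset Strict Implicit.
Unset Printing Implicit Defensive.

Import Order.TTheory GRing.Theory Num.Theory.
Import numFieldNormedType.Exports.

Local Open Scope classical_set_scope.
Local Open Scope ring_scope.

(* Index sets: objects indexed by [0, oo) are functions of t : R constrained
   only for 0 <= t; filtrations indexed by [0, oo] are functions of t : \bar R
   constrained only for 0 <= t. *)

Definition metrizable (R : realType) (E : topologicalType) : Prop :=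
  exists d : E -> E -> R,
    [/\ forall x y, 0 <= d x y,
        forall x y, d x y = 0 <-> x = y,
        forall x y, d x y = d y x,
        forall x y z, d x z <= d x y + d y z &
        forall (x : E) (A : set E),
          nbhs x A <-> exists2 e, 0 < e & [set y | d x y < e] `<=` A].

Definition sigma_compact (E : topologicalType) : Prop :=
  exists K : nat -> set E,
    (forall n, compact (K n)) /\ \bigcup_n K n = [set: E].

Notation borelType E := (g_sigma_algebraType (@open E)).

Section BoundedContinuous.
Context (R : realType) (E : topologicalType).

Definition Cb : set (E -> R) := [set f | continuous f /\ bounded_fun f].

(* Extended-real valued, so that no boundedness is presupposed. *)
Definition supnorm (f : E -> R) : \bar R :=
  ereal_sup [set `|f x|%:E | x in [set: E]].

Definition opnorm (T : (E -> R) -> (E -> R)) : \bar R :=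
  ereal_sup [set supnorm (T f) | f in Cb `&` [set f | (supnorm f <= 1)%E]].

End BoundedContinuous.

Section Semigroup.
Context (R : realType) (E : ptopologicalType).
Implicit Types Q : R -> R.-pker (borelType E) ~> (borelType E).

Definition kernel_apply (k : R.-pker (borelType E) ~> (borelType E))
    (f : E -> R) : E -> R :=
  fun x => \int[k x]_y f y.

Definition transition_semigroup Q : Prop :=
  [/\ forall x (A : set (borelType E)), measurable A -> Q 0 x A = \d_x A,
      forall (s t : R) x (A : set (borelType E)), 0 <= s -> 0 <= t -> measurable A ->
        Q (s + t) x A = (\int[Q t x]_y Q s y A)%E &
      forall A : set (borelType E), measurable A ->
        measurable_fun ([set tx | 0 <= tx.1] : set (R * borelType E))
          (fun tx => Q tx.1 tx.2 A : \bar R)].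

Definition feller_semigroup Q : Prop :=
  transition_semigroup Q /\
  forall f : E -> R, Cb f ->
    (forall t : R, 0 <= t -> Cb (kernel_apply (Q t) f)) /\
    supnorm (kernel_apply (Q t) f \- f) @[t --> 0^'+] --> 0%E.

Definition opnorm_continuous Q : Prop :=
  forall t : R, 0 <= t ->
    opnorm (fun f => kernel_apply (Q s) f \- kernel_apply (Q t) f)
      @[s --> within `[0, +oo[%classic (nbhs t)] --> 0%E.

End Semigroup.

Section Processes.
Context (R : realType) (E : ptopologicalType).
Context d (Omega : measurableType d) (P : probability Omega R).
Implicit Types (F : \bar R -> set (set Omega)) (G : R -> set (set Omega)).
Implicit Types (X : R -> Omega -> E).

Definition filtration F : Prop :=
  [/\ forall t, (0 <= t)%E -> sigma_algebra [set: Omega] (F t),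
      forall t, (0 <= t)%E -> F t `<=` measurable &
      forall s t, (0 <= s)%E -> (s <= t)%E -> F s `<=` F t].

Definition right_filtration F : R -> set (set Omega) :=
  fun t => \bigcap_(s in [set s : \bar R | (t%:E < s)%E]) F s.

Definition augmented_filtration F : R -> set (set Omega) :=
  fun t => <<s right_filtration F t `|` [set N | F +oo%E N /\ P N = 0%E] >>.

Definition sigma_gen (Y : Omega -> E) : set (set Omega) :=
  preimage_set_system [set: Omega] (Y : Omega -> borelType E) measurable.

Definition adapted G X : Prop :=
  forall t : R, 0 <= t -> sigma_gen (X t) `<=` G t.

(* Z is a version of E[Y | H]; for Y integrable and H a sub-sigma-algebra. *)
Definition is_condexp (H : set (set Omega)) (Y Z : Omega -> R) : Prop :=
  [/\ preimage_set_system [set: Omega] Z measurable `<=` H,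
      P.-integrable [set: Omega] (EFin \o Z) &
      forall A, H A ->
        (\int[P]_(w in A) (Z w)%:E = \int[P]_(w in A) (Y w)%:E)%E].

Definition markov_process (Q : R -> R.-pker (borelType E) ~> (borelType E))
    G X : Prop :=
  adapted G X /\
  forall (s t : R) (f : E -> R), 0 <= s -> 0 <= t ->
    measurable_fun [set: borelType E] f -> bounded_fun f ->
    is_condexp (sigma_gen (X s)) (f \o X (s + t)) (kernel_apply (Q t) f \o X s)
    /\ is_condexp (G s) (f \o X (s + t)) (kernel_apply (Q t) f \o X s).

Definition modification X X' : Prop :=
  forall t : R, 0 <= t ->
    measurable_fun [set: Omega] (X' t : Omega -> borelType E) /\
    {ae P, forall w, X t w = X' t w}.

Definition cadlag X : Prop :=
  forall w (t : R), 0 <= t ->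
    (X s w @[s --> t^'+] --> X t w) /\
    (0 < t -> exists l : E, X s w @[s --> t^'-] --> l).

End Processes.

(* Main.v *)
(** Continuity of [Q] in operator norm at time 0, tested on the bumps
    [max(0, 1 - n d(x,y))], says that [1 - Q_t(x,{x})] tends to 0 uniformly in
    [x]: the process is a pure-jump process with bounded rates, and no
    martingale regularization is needed.  If [Q_t(x,{x}) >= 3/4] for [t <= h],
    a first-exit argument gives [1 - Q_{h/N}(x,{x}) <= 1/(2N)], so the number of
    jumps of [B] along the dyadic grid of mesh [h/2^n] up to time [K h] has
    expectation at most [K/2] for every [n].  Almost surely the restriction of
    [B] to the dyadic times therefore has finitely many jumps on bounded
    intervals, and it is constant immediately to the right and to the left of
    every time.  Its right value [B'_t] (a fixed point of [E] on the exceptional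
    null set) is a càdlàg modification.  The Markov property for [F_t^+] follows
    by comparing time [s] with times [r > s], since [P(B_r <> B_s)] tends to 0
    as [r] decreases to [s]; completing by null sets changes no integral. *)

Require Import Defs.
From mathcomp Require Import all_boot all_order all_algebra.
From mathcomp Require Import all_classical all_reals all_analysis measurable_realfun.
From mathcomp Require Import ring lra.

Set Implicit Arguments.
Unset Strict Implicit.
Unset Printing Implicit Defensive.

Import Order.TTheory GRing.Theory Num.Theory.
Import numFieldNormedType.Exports.

Local Open Scope classical_set_scope.
Local Open Scope ring_scope.

(** * Jumps of a path along refining dyadic grids *)

Section DyadicJumps.
Context (R : realType) (E : Type) (h : R) (h0 : 0 < h).
Implicit Types b : R -> E.

Definition grid (n k : nat) : R := h * k%:R / 2 ^+ n.

Definition dyadic : set R := [set u | exists n k, u = grid n k].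

Definition jump b n k : bool := `[< b (grid n k) <> b (grid n k.+1) >].

Definition njumps b n i : nat := \sum_(k < i) jump b n k.

(** [K * 2 ^ n] steps of mesh [h / 2 ^ n] cover the time interval from 0 to [K h], so the bound [M]
    is uniform over all meshes. *)
Definition finite_jumps b : Prop :=
  forall K, exists M, forall n, (njumps b n (K * 2 ^ n) <= M)%N.

Lemma grid_refine n p k : grid (n + p) (k * 2 ^ p) = grid n k.
Proof.
rewrite /grid natrM natrX exprD; field.
by rewrite !expf_neq0 ?pnatr_eq0.
Qed.

Lemma grid_le n i j : (grid n i <= grid n j) = (i <= j)%N.
Proof.
by rewrite /grid ler_pM2r ?invr_gt0 ?exprn_gt0// ler_pM2l// ler_nat.
Qed.

Lemma grid_ge0 n i : 0 <= grid n i.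
Proof. by rewrite /grid divr_ge0 ?mulr_ge0 ?exprn_ge0// ltW. Qed.

(** A jump across a coarse step forces a jump across at least one of its two halves. *)
Lemma njumps_double b n i : (njumps b n i <= njumps b n.+1 (i * 2))%N.
Proof.
have g2 k : grid n k = grid n.+1 (k * 2) by rewrite -(grid_refine n 1) addn1.
elim: i => [|i IH]; first by rewrite /njumps big_ord0.
rewrite mulSn add2n /njumps big_ord_recr/= 2!big_ord_recr/= -addnA leq_add//.
have [|] := boolP (jump b n i) => [/asboolP neq|//].
have [//|/asboolP/contrapT eq1] := boolP (jump b n.+1 (i * 2)).
have [//|/asboolP/contrapT eq2] := boolP (jump b n.+1 (i * 2).+1).
by case: neq; rewrite !g2 eq1 eq2.
Qed.

Lemma njumps_refine b n p i : (njumps b n i <= njumps b (n + p) (i * 2 ^ p))%N.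
Proof.
elim: p => [|p IH]; first by rewrite addn0 muln1.
by rewrite (leq_trans IH)// addnS expnSr mulnA njumps_double.
Qed.

Lemma njumpsS b n i : njumps b n i.+1 = (njumps b n i + jump b n i)%N.
Proof. by rewrite /njumps big_ord_recr. Qed.

(** Without a jump in the steps from [i] to [i + l] the two end values would agree; the Boolean
    counts as 0 or 1. *)
Lemma njumps_jump b n i l :
  (njumps b n i + `[< b (grid n i) <> b (grid n (i + l)) >] <= njumps b n (i + l))%N.
Proof.
elim: l => [|l IH].
  by rewrite addn0 (_ : `[< _ >] = false) ?addn0//; apply/asboolP.
rewrite addnS njumpsS; have [/asboolP neq|] := boolP `[< _ >]; last first.
  by move=> _; rewrite addn0 (leq_trans _ (leq_addr _ _))// (leq_trans (leq_addr _ _) IH).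
have [j|/asboolP/contrapT e] := boolP (jump b n (i + l)).
  by rewrite leq_add// (leq_trans (leq_addr _ _) IH).
by rewrite addn0 (leq_trans _ IH)// leq_add2l lt0b; apply/asboolP; rewrite e.
Qed.

Lemma njumps_le b n i j : (i <= j)%N -> (njumps b n i <= njumps b n j)%N.
Proof.
by move=> /subnKC <-; apply: leq_trans (njumps_jump b n i (j - i)); exact: leq_addr.
Qed.

Lemma dyadic_ge0 u : dyadic u -> 0 <= u.
Proof. by move=> [n [k ->]]; apply: grid_ge0. Qed.

Lemma dyadic_dense a c : 0 <= a -> a < c -> exists2 u, dyadic u & a < u < c.
Proof.
move=> a0 ac.
pose n := (Num.truncn (h / (c - a))).+1.
have hn : h / 2 ^+ n < c - a.
  rewrite ltr_pdivrMr ?exprn_gt0// mulrC -ltr_pdivrMr ?subr_gt0//.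
  rewrite (lt_le_trans (truncnS_gt _))// -/n -natrX ler_nat.
  by rewrite ltnW// ltn_expl.
pose k := Num.truncn (a * 2 ^+ n / h).
have x0 : 0 <= a * 2 ^+ n / h by rewrite divr_ge0 ?mulr_ge0 ?exprn_ge0 ?(ltW h0).
have /andP[k1 k2] := truncn_itv x0.
have p0 : 0 < (2 : R) ^+ n by rewrite exprn_gt0.
(* The first grid point strictly after [a]: [grid n k] is at most [a], and the mesh is less than
   [c - a]. *)
exists (grid n k.+1); first by exists n, k.+1.
rewrite /grid; apply/andP; split.
  by rewrite ltr_pdivlMr// [h * _]mulrC -ltr_pdivrMr.
rewrite -natr1 mulrDr mulr1 mulrDl -ltrBrDr (le_lt_trans _ (_ : a < _))//.
  by rewrite ler_pdivrMr// [h * _]mulrC -ler_pdivlMr.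
by rewrite ltrBrDr addrC -ltrBrDr.
Qed.

(** For dyadic [u], [J u] is the largest number of jumps before [u] counted on a grid containing
    [u]. This integer clock reduces local constancy of [b] to extremal values of [J]. *)
Lemma jump_clock b : finite_jumps b ->
  exists J : R -> nat, forall u v, dyadic u -> dyadic v -> u <= v ->
    (J u <= J v)%N /\ (J u = J v -> b u = b v).
Proof.
move=> fb.
pose V u : set nat := [set m | exists n i, grid n i = u /\ njumps b n i = m].
have /choice[J JP] : forall u, exists m, dyadic u ->
    V u m /\ forall m', V u m' -> (m' <= m)%N.
  move=> u; have [[n [i ->]]|nD] := pselect (dyadic u); last by exists 0%N.
  have [K ltK] : exists K, grid n i <= grid 0 K.
    exists i; rewrite -(grid_refine 0 n) add0n grid_le.
    by rewrite leq_pmulr// expn_gt0.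
  have [M HM] := fb K.
  have bV m' : V (grid n i) m' -> (m' <= M)%N.
    move=> [m [j [eji <-]]]; apply: leq_trans (HM m); apply: njumps_le.
    by rewrite -(grid_le m) eji -[m in grid m (K * _)]add0n grid_refine.
  have ex : exists m, `[< V (grid n i) m >].
    by exists (njumps b n i); apply/asboolP; exists n, i.
  have bV' m' : `[< V (grid n i) m' >] -> (m' <= M)%N by move/asboolP/bV.
  exists (ex_maxn ex bV') => _; case: ex_maxnP => m /asboolP Vm mP.
  by split=> // m' Vm'; apply: mP; apply/asboolP.
exists J => u v Du Dv uv.
have [[n [i [gu <-]]] _] := JP u Du; have [_ mv] := JP v Dv.
have [m [j gv]] := Dv.
(* Counts on different grids are compared on the common refinement of level [n + m]. *)
have gu' : u = grid (n + m) (i * 2 ^ m) by rewrite grid_refine.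
have gv' : v = grid (n + m) (j * 2 ^ n) by rewrite addnC grid_refine.
have ij : (i * 2 ^ m <= j * 2 ^ n)%N by rewrite -(grid_le (n + m)) -gu' -gv'.
have Jv : (njumps b (n + m) (j * 2 ^ n) <= J v)%N.
  by apply: mv; exists (n + m)%N, (j * 2 ^ n)%N.
have Ju := njumps_refine b n m i.
split.
  by rewrite (leq_trans Ju)// (leq_trans _ Jv)// njumps_le.
(* If [b u] and [b v] differed, the count at [v] on the common grid would be at least [J u + 1],
   which exceeds [J v]. *)
move=> JJ; apply: contrapT => neq.
have := njumps_jump b (n + m) (i * 2 ^ m) (j * 2 ^ n - i * 2 ^ m).
rewrite subnKC// -gu' -gv' (_ : `[< _ >] = true); last exact/asboolP.
move=> /(leq_trans _)-/(_ (njumps b n i).+1).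
by rewrite addn1 ltnS Ju => /(_ isT)/leq_trans/(_ Jv); rewrite JJ ltnn.
Qed.

(** The clock attains its minimum over the dyadic times after [t] at some [s]; being monotone, it is
    constant on the dyadic times in [(t, s]], and hence so is [b]. *)
Lemma dyadic_right_const b t : finite_jumps b -> 0 <= t ->
  exists s, [/\ dyadic s, t < s &
    forall u, dyadic u -> t < u -> u <= s -> b u = b s].
Proof.
move=> /jump_clock[J JP] t0.
have exJ : exists m, `[< exists s, [/\ dyadic s, t < s & J s = m] >].
  have [s Ds /andP[ts _]] := dyadic_dense t0 (ltr_pwDr ltr01 (lexx t)).
  by exists (J s); apply/asboolP; exists s.
have [m /asboolP[s [Ds ts <-]] mP] := ex_minnP exJ.
exists s; split=> // u Du tu us.
have [le_us] := JP u s Du Ds us; apply.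
apply/eqP; rewrite eqn_leq le_us mP//.
by apply/asboolP; exists u.
Qed.

(** Here the clock is maximized over the dyadic times before [t]; its value at a dyadic [v] after
    [t] bounds it, so the maximum exists. *)
Lemma dyadic_left_const b t : finite_jumps b -> 0 < t ->
  exists s, [/\ dyadic s, s < t &
    forall u, dyadic u -> s <= u -> u < t -> b u = b s].
Proof.
move=> /jump_clock[J JP] t0.
have [v Dv /andP[tv _]] := dyadic_dense (ltW t0) (ltr_pwDr ltr01 (lexx t)).
have exJ : exists m, `[< exists s, [/\ dyadic s, s < t & J s = m] >].
  have [s Ds /andP[_ st]] := dyadic_dense (lexx 0) t0.
  by exists (J s); apply/asboolP; exists s.
have bJ m : `[< exists s, [/\ dyadic s, s < t & J s = m] >] -> (m <= J v)%N.
  move=> /asboolP[s [Ds st <-]].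
  by have [] := JP s v Ds Dv (ltW (lt_trans st tv)).
have [m /asboolP[s [Ds st <-]] mP] := ex_maxnP exJ bJ.
exists s; split=> // u Du su ut.
have [le_us e] := JP s u Ds Du su; apply/esym/e.
apply/eqP; rewrite eqn_leq le_us mP//.
by apply/asboolP; exists u.
Qed.

End DyadicJumps.

(** * Metric spaces: bump functions, separating sets, operator norm *)

Lemma bounded_funP (T : Type) (R : realType) (f : T -> R) :
  bounded_fun f <-> exists M, forall x, `|f x| <= M.
Proof.
split=> [[M [_ HM]]|[M HM]].
  by exists (M + 1) => x; apply: HM; rewrite ?ltrDl.
exists M; split; first exact: num_real.
by move=> N MN x _; exact: le_trans (HM x) (ltW MN).
Qed.

Section Metric.
Context (R : realType) (E : ptopologicalType) (d : E -> E -> R).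
Context (d_ge0 : forall x y, 0 <= d x y) (d_eq0 : forall x y, d x y = 0 <-> x = y)
  (d_sym : forall x y, d x y = d y x)
  (d_tri : forall x y z, d x z <= d x y + d y z)
  (d_nbhs : forall (x : E) (A : set E),
     nbhs x A <-> exists2 e, 0 < e & [set y | d x y < e] `<=` A).

Lemma metric_ball_open x e : open [set y | d x y < e].
Proof.
rewrite openE => y /= xye; apply/d_nbhs; exists (e - d x y).
  by rewrite subr_gt0.
by move=> z /= yz; rewrite (le_lt_trans (d_tri x y z))// -ltrBrDl.
Qed.

Lemma metric_continuous x : continuous (d x).
Proof.
move=> y; apply/cvgrPdist_lt => e e0.
apply/d_nbhs; exists e => // z /= yz.
rewrite ltr_norml; apply/andP; split.
  rewrite ltrNl opprB ltrBlDl (le_lt_trans (d_tri x y z))// ltrD2l//.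
by rewrite ltrBlDl (le_lt_trans (d_tri x z y))// ltrD2l d_sym.
Qed.

Definition bump x n (y : E) : R := Num.max 0 (1 - n.+1%:R * d x y).

Lemma bump_ge0 x n y : 0 <= bump x n y.
Proof. by rewrite /bump le_max lexx. Qed.

Lemma bump_le1 x n y : bump x n y <= 1.
Proof. by rewrite /bump ge_max ler01 gerBl mulr_ge0. Qed.

Lemma bump_center x n : bump x n x = 1.
Proof. by rewrite /bump (iffRL (d_eq0 x x) erefl) mulr0 subr0 max_r. Qed.

Lemma bump_continuous x n : continuous (bump x n).
Proof.
move=> y; apply: (@continuous_max R E (fun=> 0) (fun y => 1 - n.+1%:R * d x y)).
  exact: cvg_cst.
apply: cvgB; first exact: cvg_cst.
by apply: cvgM; [exact: cvg_cst|exact: metric_continuous].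
Qed.

Lemma bump_Cb x n : Cb (bump x n).
Proof.
split; first exact: bump_continuous.
by apply/bounded_funP; exists 1 => y; rewrite ger0_norm ?bump_ge0 ?bump_le1.
Qed.

Lemma supnorm_bump x n : (supnorm (bump x n) <= 1)%E.
Proof.
apply: ge_ereal_sup => _ [y _ <-].
by rewrite lee_fin ger0_norm ?bump_ge0 ?bump_le1.
Qed.

Definition small_ball x n : set E := [set y | d x y < n.+1%:R^-1].

Lemma bump_le_indic x n y : bump x n y <= \1_(small_ball x n) y.
Proof.
rewrite indicE; have [|/negP] := boolP (y \in small_ball x n).
  by rewrite bump_le1.
rewrite inE /small_ball/= => /negP; rewrite -leNgt => H.
by rewrite /bump ge_max lexx/= subr_le0 -ler_pdivrMl// mulr1.
Qed.

Lemma bigcap_small_ball x : \bigcap_n small_ball x n = [set x].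
Proof.
apply/seteqP; split=> [y Hy|y -> n _]; last first.
  by rewrite /small_ball/= (iffRL (d_eq0 x x) erefl) invr_gt0.
apply/esym/d_eq0/eqP; rewrite eq_le d_ge0 andbT leNgt; apply/negP => dpos.
have [n _ /(_ n (leqnn n)) /= Hn] := near_infty_natSinv_lt (PosNum dpos).
by have := lt_trans Hn (Hy n I); rewrite ltxx.
Qed.

Lemma metric_measurable_small_ball x n : measurable (small_ball x n : set (borelType E)).
Proof. by apply: sub_sigma_algebra; exact: metric_ball_open. Qed.

Lemma metric_measurable_set1 x : measurable ([set x] : set (borelType E)).
Proof.
rewrite -bigcap_small_ball; apply: bigcapT_measurable => n.
exact: metric_measurable_small_ball.
Qed.

(** Each [K n] is covered by finitely many balls of radius [1 / (k + 1)]; over all [n] and [k] these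
    balls are countably many, and small enough to separate points. *)
Lemma metric_countable_separating : sigma_compact E ->
  exists U : nat -> set E, (forall i, open (U i)) /\
    forall x y, x <> y -> exists2 i, U i x & ~ U i y.
Proof.
move=> [K [cK KT]].
have /choice[c cP] : forall nk : nat * nat, exists s : seq E,
    K nk.1 `<=` [set y | exists2 x, x \in s & small_ball x nk.2 y].
  move=> [n k] /=; have := cK n; rewrite compact_cover => /(_ E setT (small_ball^~ k)).
  case=> [x _|y Ky|D _ KD]; first exact: metric_ball_open.
    by exists y => //=; rewrite /small_ball/= (iffRL (d_eq0 y y) erefl) invr_gt0.
  by exists (finmap.enum_fset D) => y /KD[x /= Dx yx]; exists x.
(* An index codes a triple: the compact set, the radius, the position in the list of centers.
   Positions past the end give balls around [point], which are open as well. *)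
exists (fun j => if @unpickle (nat * nat * nat)%type j is Some (n, k, i)
  then small_ball (nth point (c (n, k)) i) k else set0).
split=> [j|x y /eqP xy].
  by case: unpickle => [[[n k] i]|]; [exact: metric_ball_open|exact: open0].
(* A ball of radius below half of [d x y] cannot contain both points. *)
have dpos : 0 < d x y / 2.
  rewrite divr_gt0// lt_neqAle d_ge0 andbT eq_sym.
  by apply: contra_neq xy => /d_eq0.
have [k _ /(_ k (leqnn k)) /= Hk] := near_infty_natSinv_lt (PosNum dpos).
have [n _ Kx] : (\bigcup_n K n) x by rewrite KT.
have [z zc zx] := cP (n, k) x Kx.
exists (pickle (n, k, index z (c (n, k)))); rewrite pickleK nth_index//.
rewrite /small_ball/= in zx * => zy.
have := d_tri x z y; rewrite [d x z]d_sym leNgt => /negP; apply.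
by rewrite (splitr (d x y)) ltrD// (lt_trans _ Hk).
Qed.

Lemma continuous_borel_measurable (f : E -> R) : continuous f ->
  measurable_fun [set: borelType E] f.
Proof.
move=> /continuousP cf; apply: (measurability _ (RGenOpens.measurableE R)).
move=> _ [_ [a [b ->] <-]]; rewrite setTI.
by apply: sub_sigma_algebra; exact/cf/interval_open.
Qed.

Section OpNorm.
Context (Q : R -> R.-pker (borelType E) ~> (borelType E)).
Context (Q0 : forall x (A : set (borelType E)), measurable A -> Q 0 x A = \d_x A).

Lemma kernel_apply_Q0 f x : measurable_fun [set: borelType E] f ->
  kernel_apply (Q 0) f x = f x.
Proof.
move=> mf; rewrite /kernel_apply /Rintegral.
rewrite (eq_measure_integral (\d_(x : borelType E) : measure _ R)); last first.
  by move=> A mA _; rewrite Q0.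
by rewrite integral_dirac ?diracT ?mul1e//; exact/measurable_EFinP.
Qed.

(** Each bump has norm at most 1 and value 1 at [x], so its integral against [Q s x] is at least
    [1 - e]. It lies below the indicator of a ball; the balls shrink to [{x}] and the bound does not
    depend on [n], so continuity from above concludes. *)
Lemma opnorm_diag (s e : R) :
  (opnorm (fun f => kernel_apply (Q s) f \- kernel_apply (Q 0) f)%R <= e%:E)%E ->
  forall x, ((1 - e)%:E <= Q s x [set x])%E.
Proof.
move=> He x.
have mb n : measurable_fun [set: borelType E] (bump x n).
  by apply: continuous_borel_measurable; exact: bump_continuous.
have Hn n : ((1 - e)%:E <= Q s x (small_ball x n))%E.
  have ib : (Q s x).-integrable setT (EFin \o bump x n).
    apply: measurable_bounded_integrable => //.
      by rewrite prob_kernel ltry.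
    by have [] := bump_Cb x n.
  apply: (@le_trans _ _ (kernel_apply (Q s) (bump x n) x)%:E).
    have h1 : (supnorm (kernel_apply (Q s) (bump x n) \-
        kernel_apply (Q 0) (bump x n))%R <= e%:E)%E.
      apply: le_trans He; apply: ereal_sup_ubound; exists (bump x n) => //.
      by split; [exact: bump_Cb|exact: supnorm_bump].
    have : (`|kernel_apply (Q s) (bump x n) x - 1|%:E <= e%:E)%E.
      apply: le_trans h1; apply: ereal_sup_ubound; exists x => //=.
      by rewrite (kernel_apply_Q0 x (mb n)) bump_center.
    by rewrite !lee_fin ler_distl => /andP[].
  rewrite /kernel_apply /Rintegral fineK; last first.
    exact: integrable_fin_num.
  apply: (@le_trans _ _ (\int[Q s x]_y (\1_(small_ball x n) y)%:E)%E).
    apply: ge0_le_integral => //.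
    - by move=> y _; rewrite lee_fin bump_ge0.
    - exact/measurable_EFinP.
    - apply/measurable_EFinP; apply: measurable_indic; exact: metric_measurable_small_ball.
    - by move=> y _; rewrite lee_fin bump_le_indic.
  by rewrite integral_indic ?setIT//; exact: metric_measurable_small_ball.
rewrite -bigcap_small_ball.
have H := @nonincreasing_cvg_mu _ _ _ (Q s x) (small_ball x).
have {H} := H _ (metric_measurable_small_ball x) _ _.
rewrite -/(small_ball x) => H.
have {}H : (Q s x \o small_ball x) @ \oo --> Q s x (\bigcap_n small_ball x n).
  apply: H.
  - rewrite (le_lt_trans _ (ltry 1))// -(prob_kernel (s := Q s) x).
    by apply: le_measure; rewrite ?inE//; exact: metric_measurable_small_ball.
  - by apply: bigcapT_measurable => n; exact: metric_measurable_small_ball.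
  - move=> n m nm; apply/subsetPset => y; rewrite /small_ball/= => /lt_le_trans; apply.
    by rewrite lef_pV2 ?posrE// ler_nat.
rewrite -(cvg_lim _ H)//; apply: lime_ge; first by apply/cvg_ex; eexists; exact: H.
by apply: nearW => n; exact: Hn.
Qed.

End OpNorm.

End Metric.

(** * A bound, linear in time, on the probability of leaving a point *)

Lemma ge0_integral_le_cst d (T : measurableType d) (R : realType)
    (mu : {measure set T -> \bar R}) (D : set T) (f : T -> \bar R) (c : R) :
  measurable D -> measurable_fun D f -> (forall x, D x -> 0 <= f x)%E ->
  (forall x, D x -> f x <= c%:E)%E -> (\int[mu]_(x in D) f x <= c%:E * mu D)%E.
Proof.
move=> mD mf f0 fc; rewrite -integral_cst//.
exact: ge0_le_integral.
Qed.

(** Bernoulli's inequality in a form without division by [q]; it turns a lower bound on [q ^+ n]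
    into an upper bound on [n (1 - q)]. *)
Lemma expr_bernoulli (R : realType) (q : R) n : 0 <= q <= 1 ->
  q ^+ n * (1 + n%:R * (1 - q)) <= 1.
Proof.
move=> /andP[q0 q1]; elim: n => [|n IH]; first by rewrite mul0r addr0 mul1r.
have -> : q ^+ n.+1 * (1 + n.+1%:R * (1 - q)) =
    q * (q ^+ n * (1 + n%:R * (1 - q))) + q ^+ n.+1 * (1 - q).
  by rewrite exprS -natr1; ring.
rewrite (@le_trans _ _ (q * 1 + 1 * (1 - q)))//; last by rewrite mulr1 mul1r addrC subrK.
apply: lerD; first exact: ler_wpM2l.
by rewrite ler_wpM2r ?subr_ge0// exprn_ile1.
Qed.

(* For a chain that keeps its state with probability at least 3/4 over any
   number of steps, [a k] is the probability of being at the starting point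
   after [k] steps and [q ^+ k] that of never having left it. *)
Lemma first_exit_bound (R : realType) (a : nat -> R) (q : R) N : 0 <= q <= 1 ->
  a 0%N = 1 -> (forall k, (k < N)%N -> a k.+1 <= q * a k + (1 - q) / 4) -> 3 / 4 <= a N ->
  (0 < N)%N -> 1 - q <= (2 * N%:R)^-1.
Proof.
move=> /andP[q0 q1] a0 aS aN N0.
have H k : (k <= N)%N -> a k <= q ^+ k + (1 - q ^+ k) / 4.
  elim: k => [|k IH kN]; first by rewrite a0 expr0; lra.
  rewrite (le_trans (aS _ kN))// exprS.
  have := ler_wpM2l q0 (IH (ltnW kN)); lra.
(* This comes from [3 / 4 <= 1 / 4 + 3 / 4 * q ^+ N]; Bernoulli's inequality then leaves [N (1 - q)]
   at most 1/2. *)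
have qN : 2 / 3 <= q ^+ N by have := H N (leqnn N); lra.
have := @expr_bernoulli R q N; rewrite q0 q1 => /(_ isT) qb.
have Nq : 0 <= N%:R * (1 - q) by rewrite mulr_ge0// subr_ge0.
have : 1 + N%:R * (1 - q) <= 3 / 2.
  have := ler_wpM2r (addr_ge0 ler01 Nq) qN; lra.
have Np : 0 < N%:R :> R by rewrite ltr0n.
move=> H2; rewrite -(ler_pM2l Np) invfM mulrCA mulfV ?gt_eqF// mulr1; lra.
Qed.

Section Kernel.
Context (R : realType) (E : ptopologicalType).
Context (Q : R -> R.-pker (borelType E) ~> (borelType E)).
Context (set1_measurable : forall x : E, measurable ([set x] : set (borelType E))).

Lemma kernel_fin_num t x (A : set (borelType E)) : measurable A -> Q t x A \is a fin_num.
Proof. by move=> mA; apply: kernel_finite_transition. Qed.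

Lemma kernel_setC t x (A : set (borelType E)) : measurable A ->
  (Q t x (~` A) = 1 - Q t x A)%E.
Proof.
have Q1 : Q t x setT = 1%E by exact: prob_kernel.
move=> mA; rewrite -setTD measureD//; last by rewrite [ltLHS]Q1 ltry.
by rewrite setTI; congr (_ - _)%E.
Qed.

Lemma kernel_away t (e : R) x (A : set (borelType E)) :
  ((1 - e)%:E <= Q t x [set x])%E -> measurable A -> ~ A x -> (Q t x A <= e%:E)%E.
Proof.
move=> Hx mA nAx; apply: (@le_trans _ _ (Q t x (~` [set x]))).
  apply: le_measure; rewrite ?inE//; first exact: measurableC.
  by move=> y Ay /= yx; apply: nAx; rewrite -yx.
by rewrite kernel_setC// leeBlDr ?kernel_fin_num// -leeBlDl.
Qed.

(** The process observed with step [h / N] falls under the first-exit bound: from a point other than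
    [x], the chance of being at [x] after a time up to [h] is at most 1/4, since that point keeps
    its own state with probability at least 3/4. *)
Lemma diag_linear_bound (h : R) : 0 < h -> transition_semigroup Q ->
  (forall s x, 0 <= s <= h -> ((1 - 4^-1)%:E <= Q s x [set x])%E) ->
  forall N, (0 < N)%N -> forall x,
    ((1 - (2 * N%:R)^-1)%:E <= Q (h / N%:R) x [set x])%E.
Proof.
move=> h0 [Q0 QD _] Hh N N0 x.
pose r := h / N%:R.
have r0 : 0 <= r by rewrite divr_ge0// ltW.
have Np : 0 < N%:R :> R by rewrite ltr0n.
have rk k : (k <= N)%N -> 0 <= r * k%:R <= h.
  move=> kN; rewrite mulr_ge0//= /r mulrAC -mulrA ger_pMr//.
  by rewrite ler_pdivrMr// mul1r ler_nat.
pose a k := fine (Q (r * k%:R) x [set x]).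
pose q := fine (Q r x [set x]).
have aE k : Q (r * k%:R) x [set x] = (a k)%:E by rewrite fineK// kernel_fin_num.
have qE : Q r x [set x] = q%:E by rewrite fineK// kernel_fin_num.
have q01 : 0 <= q <= 1.
  rewrite -2!lee_fin -qE measure_ge0/= -(prob_kernel (s := Q r) x).
  by apply: le_measure; rewrite ?inE.
rewrite qE lee_fin lerBlDr -lerBlDl.
apply: (@first_exit_bound R a q N) => //.
- by rewrite /a mulr0 Q0// diracE mem_set.
- move=> k kN; rewrite -lee_fin -aE.
  have /andP[rk0 _] := rk k (ltnW kN).
  (* Chapman-Kolmogorov conditions on the first step, of length [r]; the integral is then split into
     staying at [x] and moving away. *)
  rewrite -natr1 mulrDr mulr1 QD//.
  have mQ : measurable_fun [set: borelType E] (fun y => Q (r * k%:R) y [set x]).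
    exact: measurable_kernel.
  rewrite -(setUv [set x]) ge0_integral_setU//; last 3 first.
  + exact: measurableC.
  + by rewrite setUv.
  + by apply/disj_setPCl.
  rewrite EFinD; apply: leeD.
    apply: (@le_trans _ _ ((a k)%:E * Q r x [set x])%E).
      apply: ge0_integral_le_cst => //.
      + exact: measurable_funTS.
      + by move=> y /= ->; rewrite aE.
    by rewrite qE -EFinM mulrC.
  apply: (@le_trans _ _ ((4^-1)%:E * Q r x (~` [set x]))%E).
    apply: ge0_integral_le_cst => //.
    + exact: measurableC.
    + exact: measurable_funTS.
    + move=> y /= yx; apply: kernel_away => //; exact/Hh/rk/ltnW.
  by rewrite kernel_setC// qE -EFinB -EFinM mulrC.
- rewrite -lee_fin -aE (le_trans _ (Hh _ x (rk N (leqnn N))))// lee_fin; lra.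
Qed.

End Kernel.

(** * Probability that two random points differ *)

Lemma measurable_fun_preimage d d' (T : measurableType d) (T' : measurableType d')
    (Y : T -> T') A : measurable_fun setT Y -> measurable A -> measurable (Y @^-1` A).
Proof. by move=> mY mA; rewrite -[X in measurable X]setTI; exact: mY. Qed.

Section Separation.
Context (R : realType) (E : ptopologicalType) (U : nat -> set E).
Context (U_open : forall i, open (U i)).
Context (U_sep : forall x y, x <> y -> exists2 i, U i x & ~ U i y).

Definition differ (T : Type) (Y Z : T -> E) i : set T :=
  (Y @^-1` U i `\` Z @^-1` U i) `|` (Z @^-1` U i `\` Y @^-1` U i).

(** The separating family writes the event as a countable union, which gives its measurability and
    an approximation by finite unions. *)
Lemma neq_bigcup_differ (T : Type) (Y Z : T -> E) :
  [set w | Y w <> Z w] = \bigcup_i differ Y Z i.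
Proof.
apply/seteqP; split=> [w /= /U_sep[i Yi Zi]|w [i _ H] /= e].
  by exists i => //; left.
by case: H => -[/=]; rewrite e.
Qed.

Lemma U_borel i : measurable (U i : set (borelType E)).
Proof. by apply: sub_sigma_algebra; exact: U_open. Qed.

Lemma measurable_neq d (T : measurableType d) (Y Z : T -> borelType E) :
  measurable_fun setT Y -> measurable_fun setT Z ->
  measurable [set w | (Y w : E) <> Z w].
Proof.
move=> mY mZ; rewrite neq_bigcup_differ; apply: bigcupT_measurable => i.
have m1 := measurable_fun_preimage mY (U_borel i).
have m2 := measurable_fun_preimage mZ (U_borel i).
by apply: measurableU; exact: measurableD.
Qed.

(* Induction on the number of separating sets [U i] that are taken into account:
   [A] is split into [A `&` U k] and [A `\` U k] and the bound, linear in
   [P (Y @^-1` A)], is additive. *)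
Lemma prob_neq_le d (T : measurableType d) (P : probability T R)
    (Y Z : T -> borelType E) (e : R) :
  measurable_fun setT Y -> measurable_fun setT Z ->
  (forall A, measurable A -> (P (Y @^-1` A `\` Z @^-1` A) <= e%:E * P (Y @^-1` A))%E) ->
  (P [set w | (Y w : E) <> Z w] <= e%:E)%E.
Proof.
move=> mY mZ H.
have mpY A : measurable A -> measurable (Y @^-1` A) by exact: measurable_fun_preimage.
have mpZ A : measurable A -> measurable (Z @^-1` A) by exact: measurable_fun_preimage.
pose D k := \bigcup_(i < k) differ Y Z i.
have mN i : measurable (differ Y Z i).
  by apply: measurableU; apply: measurableD; (apply: mpY || apply: mpZ); exact: U_borel.
have mD k : measurable (D k) by apply: bigcup_measurable => i _; exact: mN.
have DS k : D k.+1 = D k `|` differ Y Z k.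
  by rewrite /D [X in bigcup X]IIS bigcup_setU bigcup_set1.
have key k : forall A, measurable A ->
    (P (Y @^-1` A `&` (~` (Z @^-1` A) `|` D k)) <= e%:E * P (Y @^-1` A))%E.
  elim: k => [|k IH] A mA.
    by rewrite /D II0 bigcup_set0 setU0 -setDE; exact: H.
  have mAU : measurable (A `&` U k) by apply: measurableI => //; exact: U_borel.
  have mAD : measurable (A `\` U k) by apply: measurableD => //; exact: U_borel.
  have disj : Y @^-1` (A `&` U k) `&` Y @^-1` (A `\` U k) = set0.
    by apply/seteqP; split=> // w [[_ /= ?] [_ /=]].
  have -> : P (Y @^-1` A) = (P (Y @^-1` (A `&` U k)) + P (Y @^-1` (A `\` U k)))%E.
    rewrite -measureU//; [|exact: mpY|exact: mpY].
    by rewrite -preimage_setU setUIDK.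
  rewrite ge0_muleDr//.
  apply: le_trans (leeD (IH _ mAU) (IH _ mAD)).
  have mS B : measurable B -> measurable (Y @^-1` B `&` (~` (Z @^-1` B) `|` D k)).
    move=> mB; apply: measurableI; first exact: mpY.
    by apply: measurableU => //; apply: measurableC; exact: mpZ.
  rewrite -measureU; [|exact: mS|exact: mS|].
    apply: le_measure; rewrite ?inE.
    - apply: measurableI; first exact: mpY.
      by apply: measurableU => //; apply: measurableC; exact: mpZ.
    - by apply: measurableU; exact: mS.
    (* If [Y w] is in [U k], a difference detected by [U k] means that [Z w] is outside [U k], hence
       outside the part of [A] within [U k]; the other half is symmetric. *)
    rewrite DS => w [/= Aw].
    have [Uw|nUw] := pselect (U k (Y w)).
      move=> Hw; left; split => //=.
      case: Hw => [nA|[Dw|[[]|[]]]//]; [left => -[] //|by right|by left => -[]].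
    move=> Hw; right; split => //=.
    case: Hw => [nA|[Dw|[[]|[]]]//]; [left => -[] //|by right|by left => -[]].
  by apply/seteqP; split=> // w [[[_ /= ?] _] [[_ /=]]].
have PD k : (P (D k) <= e%:E)%E.
  have := key k setT measurableT.
  by rewrite !preimage_setT setCT set0U setTI probability_setT mule1.
rewrite neq_bigcup_differ.
have -> : \bigcup_i differ Y Z i = \bigcup_k D k.
  apply/seteqP; split=> w [i _ wi]; first by exists i.+1 => //; exists i => /=.
  by case: wi => j _ ?; exists j.
have H' : (P \o D) @ \oo --> P (\bigcup_k D k).
  apply: nondecreasing_cvg_mu => //; first exact: bigcupT_measurable.
  move=> n m nm; apply/subsetPset => w [i /= ik ?]; exists i => //=.
  exact: leq_trans nm.
rewrite -(cvg_lim _ H')//; apply: lime_le; first by apply/cvg_ex; eexists; exact: H'.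
by apply: nearW => n; exact: PD.
Qed.

End Separation.

(** * Jump probabilities of the Markov process *)

Section Process.
Context (R : realType) (E : ptopologicalType) (U : nat -> set E).
Context (U_open : forall i, open (U i)).
Context (U_sep : forall x y, x <> y -> exists2 i, U i x & ~ U i y).
Context (set1_measurable : forall x : E, measurable ([set x] : set (borelType E))).
Context d (Omega : measurableType d) (P : probability Omega R).

Lemma sigma_gen_measurable (Y : Omega -> E) : sigma_gen Y `<=` measurable ->
  measurable_fun setT (Y : Omega -> borelType E).
Proof. by move=> H _ A mA; apply: H; exists A. Qed.

(** With the indicator of the complement of [A] as test function, the Markov property on the event
    that [X s] is in [A] gives the probability of leaving [A]. It is at most [e] times that of
    starting there, as [prob_neq_le] asks. *)
Lemma markov_jump_prob (Q : R -> R.-pker (borelType E) ~> (borelType E))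
    (G : R -> set (set Omega)) (X : R -> Omega -> E) (s t e : R) :
  markov_process P Q G X -> (forall t, 0 <= t -> G t `<=` measurable) ->
  0 <= s -> 0 <= t ->
  (forall x, ((1 - e)%:E <= Q t x [set x])%E) ->
  (P [set w | X s w <> X (s + t)%R w] <= e%:E)%E.
Proof.
move=> [adX mkX] mG s0 t0 He.
have mX r : 0 <= r -> measurable_fun setT (X r : Omega -> borelType E).
  move=> r0; apply: sigma_gen_measurable; apply: subset_trans (mG r r0); exact: adX.
have mXs := mX _ s0; have mXst := mX _ (addr_ge0 s0 t0).
apply: (prob_neq_le U_open U_sep mXs mXst) => A mA.
pose f : borelType E -> R := \1_(~` A).
have mf : measurable_fun setT f by apply: measurable_indic; exact: measurableC.
have bf : bounded_fun f.
  by apply/bounded_funP; exists 1 => x; rewrite /f indicE; case: (_ \in _); rewrite ?normr1 ?normr0.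
have [_ [_ iZ /(_ (X s @^-1` A))]] := mkX s t f s0 t0 mf bf.
have mpA := measurable_fun_preimage mXs mA.
have mpA' := measurable_fun_preimage mXst mA.
move=> H; have {}H := H (adX s s0 _ _).
have : (\int[P]_(w in X s @^-1` A) ((kernel_apply (Q t) f \o X s) w)%:E =
    P (X s @^-1` A `\` X (s + t)%R @^-1` A))%E.
  rewrite H; last by exists A => //; rewrite setTI.
  rewrite (_ : (fun w => _) = (fun w => (\1_(~` (X (s + t) @^-1` A)) w)%:E))//.
  by rewrite integral_indic// 1?setIC -?setDE//; exact: measurableC.
move=> <-; apply: ge0_integral_le_cst => //.
- have /measurable_int/measurable_funTS := iZ; exact.
- by move=> w _; rewrite lee_fin; apply: Rintegral_ge0.
- move=> w /= Aw; rewrite lee_fin /kernel_apply /Rintegral -lee_fin fineK.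
    rewrite integral_indic ?setIT//; last exact: measurableC.
    by apply: kernel_away => //; exact: measurableC.
  rewrite integral_indic ?setIT//; last exact: measurableC.
  by apply: kernel_fin_num; exact: measurableC.
Qed.

End Process.

(** * Almost sure finiteness of the number of jumps *)

Section JumpCounts.
Context (R : realType) (E : ptopologicalType) (U : nat -> set E).
Context (U_open : forall i, open (U i)).
Context (U_sep : forall x y, x <> y -> exists2 i, U i x & ~ U i y).
Context (h : R) (h0 : 0 < h).
Context d (T : measurableType d) (X : R -> T -> borelType E).
Context (mX : forall u, 0 <= u -> measurable_fun setT (X u)).

Definition jump_set n k : set T := [set w | X (grid h n k) w <> X (grid h n k.+1) w].

Lemma measurable_jump_set n k : measurable (jump_set n k).
Proof. by apply: (measurable_neq U_open U_sep); apply: mX; exact: grid_ge0. Qed.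

Lemma measurable_njumps_ge n i M :
  measurable [set w | (M <= njumps h (X^~ w) n i)%N].
Proof.
elim: i M => [|i IH] [|M].
- by rewrite [X in measurable X](_ : _ = setT)//; apply/seteqP; split.
- rewrite [X in measurable X](_ : _ = set0)//; apply/seteqP; split => // w /=.
  by rewrite /njumps big_ord0.
- by rewrite [X in measurable X](_ : _ = setT)//; apply/seteqP; split.
rewrite [X in measurable X](_ : _ = [set w | (M.+1 <= njumps h (X^~ w) n i)%N] `|`
  ([set w | (M <= njumps h (X^~ w) n i)%N] `&` jump_set n i)); last first.
  apply/seteqP; split=> w /=; rewrite njumpsS /jump.
    case: asboolP => [jmp|_]; last by rewrite addn0; left.
    by rewrite addn1 ltnS => ?; right.
  case=> [H|[H jmp]]; first exact: leq_trans (leq_addr _ _).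
  by rewrite (_ : `[< _ >] = true) ?addn1//; apply/asboolP.
by apply: measurableU => //; apply: measurableI => //; exact: measurable_jump_set.
Qed.

Definition jumps_unbounded K : set T :=
  \bigcap_M \bigcup_n [set w | (M.+1 <= njumps h (X^~ w) n (K * 2 ^ n))%N].

Lemma infinite_jumpsE :
  [set w | ~ finite_jumps h (X^~ w)] = \bigcup_K jumps_unbounded K.
Proof.
apply/seteqP; split=> w /=.
  move=> /existsNP[K /forallNP HK]; exists K => // M _.
  by have /existsNP[n /negP] := HK M; rewrite -ltnNge => ?; exists n.
move=> [K _ HK] /(_ K)[M HM]; have [n _ /=] := HK M I.
by rewrite ltnNge HM.
Qed.

Lemma measurable_jumps_unbounded K : measurable (jumps_unbounded K).
Proof.
apply: bigcapT_measurable => M; apply: bigcupT_measurable => n.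
exact: measurable_njumps_ge.
Qed.

Lemma measurable_infinite_jumps : measurable [set w | ~ finite_jumps h (X^~ w)].
Proof.
rewrite infinite_jumpsE; apply: bigcupT_measurable => K.
exact: measurable_jumps_unbounded.
Qed.

Context (P : probability T R).

(** Markov's inequality: the right side is the expected number of jumps in the first [i] steps. *)
Lemma njumps_markov n i M :
  ((M%:R)%:E * P [set w | (M <= njumps h (X^~ w) n i)%N] <=
   \sum_(k < i) P (jump_set n k))%E.
Proof.
set A := [set w | _].
have mA : measurable A by exact: measurable_njumps_ge.
have mJ := measurable_jump_set n.
rewrite -integral_cst//.
apply: (@le_trans _ _ (\int[P]_(w in A) \sum_(k < i) (\1_(jump_set n k) w)%:E)%E).
  apply: ge0_le_integral => //.
  - by move=> w _; rewrite lee_fin.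
  - apply: emeasurable_sum => k; apply/measurable_EFinP.
    by apply: measurable_indic; exact: mJ.
  move=> w /= Aw; rewrite sumEFin lee_fin.
  apply: (@le_trans _ _ (njumps h (X^~ w) n i)%:R); first by rewrite ler_nat.
  rewrite /njumps natr_sum; apply: ler_sum => k _.
  rewrite indicE /jump; case: asboolP => [jk|//].
  by rewrite mem_set.
rewrite ge0_integral_sum//; last first.
  by move=> k; apply/measurable_EFinP; apply: measurable_indic; exact: mJ.
apply: lee_sum => k _; rewrite integral_indic//.
by apply: le_measure; rewrite ?inE//; exact: measurableI.
Qed.

Context (jump_small : forall n k, (P (jump_set n k) <= ((2 * (2 ^ n)%:R)^-1)%:E)%E).

(** The expected number of jumps up to [K h] is at most [K / 2] on every grid, so more than [M]
    jumps have probability at most [K / (2 (M + 1))]. The events grow as the grid is refined, which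
    extends the bound to their union over [n]; then [M] tends to infinity. *)
Lemma jumps_unbounded_null K : P (jumps_unbounded K) = 0.
Proof.
have HM M : (P (jumps_unbounded K) <= (K%:R / 2 / M.+1%:R)%:E)%E.
  pose A n := [set w | (M.+1 <= njumps h (X^~ w) n (K * 2 ^ n))%N].
  have mA n : measurable (A n) by exact: measurable_njumps_ge.
  apply: (@le_trans _ _ (P (\bigcup_n A n))).
    apply: le_measure; rewrite ?inE//.
    - exact: measurable_jumps_unbounded.
    - exact: bigcupT_measurable.
    - by move=> w; apply.
  have H : (P \o A) @ \oo --> P (\bigcup_n A n).
    apply: nondecreasing_cvg_mu => //; first exact: bigcupT_measurable.
    move=> n m nm; apply/subsetPset => w; rewrite /A/= => /leq_trans; apply.
    rewrite -(subnKC nm) (leq_trans (njumps_refine _ _ _ (m - n) _))//.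
    by rewrite -mulnA -expnD.
  rewrite -(cvg_lim _ H)//; apply: lime_le; first by apply/cvg_ex; eexists; exact: H.
  apply: nearW => n /=.
  rewrite EFinM lee_pdivlMr// muleC (le_trans (njumps_markov _ _ _))//.
  apply: (@le_trans _ _ (\sum_(k < K * 2 ^ n) ((2 * (2 ^ n)%:R)^-1)%:E)%E).
    by apply: lee_sum.
  rewrite sumEFin lee_fin big_const_ord iter_addr_0 -[leLHS]mulr_natl natrM.
  by rewrite invfM mulrACA mulfV ?mulr1 ?lexx// pnatr_eq0 -lt0n expn_gt0.
apply/eqP; rewrite eq_le measure_ge0 andbT; apply/lee_addgt0Pr => e e0.
rewrite add0e.
have [M HMe] : exists M, K%:R / 2 / M.+1%:R <= e.
  exists (Num.truncn (K%:R / 2 / e)).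
  by rewrite ler_pdivrMr// [leRHS]mulrC -ler_pdivrMr// ltW// truncnS_gt.
by rewrite (le_trans (HM M)).
Qed.

Lemma infinite_jumps_null : P [set w | ~ finite_jumps h (X^~ w)] = 0.
Proof.
rewrite infinite_jumpsE; apply/negligibleP.
  by rewrite -infinite_jumpsE; exact: measurable_infinite_jumps.
apply: negligible_bigcup => K; apply/negligibleP.
  exact: measurable_jumps_unbounded.
exact: jumps_unbounded_null.
Qed.

End JumpCounts.

(** * The càdlàg regularization, its adaptedness and the modification property *)

Section Regularize.
Context (R : realType) (E : ptopologicalType) (h : R) (h0 : 0 < h).
Implicit Types b : R -> E.

(** The value shared by all dyadic times in some interval [(t, s]]; [xget] returns [point] when
    there is none. *)
Definition right_value b t : E :=
  xget point [set e | exists s, t < s /\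
    forall u, dyadic h u -> t < u -> u <= s -> b u = e].

Lemma right_valueP b t : finite_jumps h b -> 0 <= t ->
  exists s, t < s /\ forall u, dyadic h u -> t < u -> u <= s -> b u = right_value b t.
Proof.
move=> fb t0; rewrite /right_value; set S := [set e | _].
suff : S (xget point S) by [].
apply: xgetPex.
by have [s [Ds ts bs]] := dyadic_right_const h0 fb t0; exists (b s), s.
Qed.

(** Some dyadic time lies after [t'], before [s], and close enough to [t'] that [b] takes there both
    the value [right_value b t'] and the value [e]. *)
Lemma right_value_const b e t s : finite_jumps h b -> 0 <= t ->
  (forall u, dyadic h u -> t < u -> u < s -> b u = e) ->
  forall t', t <= t' -> t' < s -> right_value b t' = e.
Proof.
move=> fb t0 be t' tt' t's.
have t'0 := le_trans t0 tt'.
have [s' [ts' bs']] := right_valueP fb t'0.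
have ts : t' < Num.min s s' by rewrite lt_min t's.
have [u Du /andP[t'u]] := dyadic_dense h0 t'0 ts.
rewrite lt_min => /andP[us us'].
by rewrite -(bs' u)// ?ltW// be// (le_lt_trans tt').
Qed.

(** On either side of [t] the right values are constant near [t], so both limits are those of
    eventually constant functions. *)
Lemma right_value_cadlag b t : finite_jumps h b -> 0 <= t ->
  (right_value b s @[s --> t^'+] --> right_value b t) /\
  (0 < t -> exists l : E, right_value b s @[s --> t^'-] --> l).
Proof.
move=> fb t0; split.
  have [s [ts bs]] := right_valueP fb t0.
  apply: cvg_near_cst.
  apply: filterS2 (nbhs_right_gt t) (nbhs_right_lt ts) => t' tt' t's.
  apply: (right_value_const fb t0 _ (ltW tt') t's) => u Du tu us.
  by apply: bs => //; exact: ltW.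
move=> tp; have [s [Ds st bs]] := dyadic_left_const h0 fb tp.
exists (b s); apply: cvg_near_cst.
apply: filterS2 (nbhs_left_gt st) (nbhs_left_lt t) => t' st' t't.
apply: (right_value_const fb (dyadic_ge0 h0 Ds) _ (ltW st') t't) => u Du su ut.
by apply: bs => //; exact: ltW.
Qed.

Lemma dyadic_approx t : 0 <= t ->
  exists u : nat -> R, forall m, dyadic h (u m) /\ t < u m < t + m.+1%:R^-1.
Proof.
move=> t0; suff /choice : forall m : nat, exists v, dyadic h v /\ t < v < t + m.+1%:R^-1.
  by move=> [u uP]; exists u.
move=> m; have [|v Dv tv] := dyadic_dense h0 t0 (_ : t < t + m.+1%:R^-1).
  by rewrite ltrDl invr_gt0.
by exists v.
Qed.

Context d (Omega : measurableType d) (P : probability Omega R).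
Context (F : \bar R -> set (set Omega)) (F_filt : filtration F).
Context (B : R -> Omega -> E) (B_adapted : adapted (fun t => F t%:E) B).

Definition regularized (t : R) (w : Omega) : E :=
  if `[< finite_jumps h (B^~ w) >] then right_value (B^~ w) t else point.

Lemma regularized_cadlag : cadlag regularized.
Proof.
move=> w t t0; rewrite /regularized; case: asboolP => fb.
  exact: right_value_cadlag.
by split=> [|_]; [|exists point]; exact: cvg_cst.
Qed.

(** The values along [u] do not merely converge: they end up equal to the regularized value, so
    events about [regularized] become lower limits of events about [B]. *)
Lemma regularized_dyadic t u w : 0 <= t ->
  (forall m : nat, dyadic h (u m) /\ t < u m < t + m.+1%:R^-1) ->
  finite_jumps h (B^~ w) ->
  exists n, forall m, (n <= m)%N -> B (u m) w = regularized t w.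
Proof.
move=> t0 uP fb; rewrite /regularized asboolT//.
have [s [ts bs]] := right_valueP fb t0.
have st : 0 < s - t by rewrite subr_gt0.
have [n _ Hn] := near_infty_natSinv_lt (PosNum st).
exists n => m nm; have [Du /andP[tu ut]] := uP m.
apply: bs => //; apply: ltW; apply: lt_trans ut _.
by rewrite -ltrBrDl; exact: Hn.
Qed.

Lemma filtration_measurable_fun (s : \bar R) (t : R) : 0 <= t -> (t%:E <= s)%E ->
  measurable_fun [set: g_sigma_algebraType (F s)] (B t : _ -> borelType E).
Proof.
move=> t0 ts _ A mA; have [F1 F2 F3] := F_filt.
have s0 : (0 <= s)%E by rewrite (le_trans _ ts)// lee_fin.
rewrite measurable_g_measurableTypeE; last exact: F1.
apply: (F3 t%:E s); rewrite ?lee_fin//.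
by apply: B_adapted => //; exists A.
Qed.

Lemma process_measurable_fun t : 0 <= t ->
  measurable_fun [set: Omega] (B t : _ -> borelType E).
Proof.
move=> t0 _ A mA; have [_ F2 _] := F_filt; apply: (F2 t%:E); rewrite ?lee_fin//.
by apply: B_adapted => //; exists A.
Qed.

Context (U : nat -> set E) (U_open : forall i, open (U i)).
Context (U_sep : forall x y, x <> y -> exists2 i, U i x & ~ U i y).
Context (bad_null : P [set w | ~ finite_jumps h (B^~ w)] = 0%E).

(** The null sets added to the filtration are sets of [F +oo], so measurability in the ambient
    sigma-algebra is not enough; the lemma on jumps is applied to [Omega] equipped with [F +oo]. *)
Lemma bad_Foo : F +oo%E [set w | ~ finite_jumps h (B^~ w)].
Proof.
have [F1 _ _] := F_filt.
rewrite -(measurable_g_measurableTypeE (F1 +oo%E (leey _))).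
apply: (@measurable_infinite_jumps _ _ U U_open U_sep h h0 _
  (g_sigma_algebraType (F +oo%E))) => u u0.
by apply: filtration_measurable_fun => //; exact: leey.
Qed.

(** Off the exceptional set, [regularized t] is in [A] exactly when [B (u m)] is in [A] for all
    large [m]; the exceptional set itself belongs to the augmented sigma-algebra. *)
Lemma regularized_adapted : adapted (augmented_filtration P F) regularized.
Proof.
move=> t t0 _ [A mA <-]; rewrite setTI.
have [F1 F2 F3] := F_filt.
have [u uP] := dyadic_approx t0.
have ut m : t < u m by have [_ /andP[]] := uP m.
have u0 m : 0 <= u m by rewrite (le_trans t0)// ltW.
pose bad := [set w | ~ finite_jumps h (B^~ w)].
pose L := \bigcup_n \bigcap_m (B (u (n + m)%N) @^-1` A).
have RL : right_filtration F t L.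
  move=> s /= ts.
  have s0 : (0 <= s)%E by rewrite (le_trans _ (ltW ts))// lee_fin.
  (* From some [n0] on, [u m <= s] and [B (u m)] is measurable for [F s]. A lower limit is unchanged
     when its first terms are dropped, so [L] is in [F s] for every [s > t]. *)
  have [n0 Hn0] : exists n0, forall m, (n0 <= m)%N -> ((u m)%:E <= s)%E.
    case: s ts {s0} => [s| |]//; last by exists 0%N => *; exact: leey.
    rewrite lte_fin -subr_gt0 => ts.
    have [n _ Hn] := near_infty_natSinv_lt (PosNum ts).
    exists n => m nm; have [_ /andP[_ um]] := uP m.
    rewrite lee_fin; apply: ltW; apply: lt_trans um _.
    by rewrite -ltrBrDl; exact: Hn.
  have -> : L = \bigcup_n \bigcap_m (B (u (n0 + n + m)%N) @^-1` A).
    apply/seteqP; split=> w [n _ Hn].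
      by exists n => // m _; rewrite [(n0 + n)%N]addnC -addnA; exact: Hn.
    by exists (n0 + n)%N.
  rewrite -(measurable_g_measurableTypeE (F1 s s0)).
  apply: bigcupT_measurable => n; apply: bigcapT_measurable => m.
  have um : ((u (n0 + n + m)%N)%:E <= s)%E by apply: Hn0; rewrite -addnA leq_addr.
  exact: (measurable_fun_preimage (filtration_measurable_fun (u0 _) um) mA).
have mbad : augmented_filtration P F t bad.
  by apply: sub_sigma_algebra; right; split; [exact: bad_Foo|].
have mL : augmented_filtration P F t L by apply: sub_sigma_algebra; left.
have -> : regularized t @^-1` A = (L `\` bad) `|` (bad `&` [set _ | A point]).
  apply/seteqP; split=> w /=.
    have [fb|nfb] := pselect (finite_jumps h (B^~ w)).
      have [n Hn] := regularized_dyadic t0 uP fb.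
      move=> Aw; left; split; last by move=> /(_ fb).
      by exists n => // m _; rewrite /= Hn// leq_addr.
    by rewrite /regularized asboolF//; right.
  case=> [[[n _ Hn] /contrapT fb]|[nfb Ap]]; last by rewrite /regularized asboolF.
  have [n' Hn'] := regularized_dyadic t0 uP fb.
  by rewrite -(Hn' (n + n')%N) ?leq_addl//; exact: Hn.
change (@measurable _ (g_sigma_algebraType
  (right_filtration F t `|` [set N | F +oo%E N /\ P N = 0%E]))
  ((L `\` bad) `|` (bad `&` [set _ | A point]))).
apply: measurableU; first exact: measurableD.
apply: measurableI => //.
have [Ap|nAp] := pselect (A point).
  by rewrite [X in measurable X](_ : _ = setT)//; apply/seteqP; split.
by rewrite [X in measurable X](_ : _ = set0)//; apply/seteqP; split.
Qed.

Lemma augmented_measurable t : augmented_filtration P F t `<=` measurable.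
Proof.
have [F1 F2 F3] := F_filt.
apply: smallest_sub; first exact: sigma_algebra_measurable.
move=> A [RA|[FA _]]; last exact: (F2 +oo%E (leey _)).
by apply: (F2 +oo%E (leey _)); apply: RA => /=; exact: ltry.
Qed.

Lemma regularized_measurable t : 0 <= t ->
  measurable_fun [set: Omega] (regularized t : _ -> borelType E).
Proof.
move=> t0; apply: sigma_gen_measurable.
exact: subset_trans (regularized_adapted t0) (@augmented_measurable t).
Qed.

Context (B_small : forall e, 0 < e -> exists2 dl, 0 < dl &
  forall s t, 0 <= s -> s <= t -> t <= s + dl -> (P [set w | B s w <> B t w] <= e%:E)%E).

(** On a path with finitely many jumps, if [B t] differs from [regularized t], then it differs from
    [B (u m)] for all large [m]. Each intersection over a tail is null, as the probabilities of its
    members become arbitrarily small. *)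
Lemma regularized_modification : modification P B regularized.
Proof.
move=> t t0; split; first exact: regularized_measurable.
have [u uP] := dyadic_approx t0.
have ut m : t < u m by have [_ /andP[]] := uP m.
have u0 m : 0 <= u m by rewrite (le_trans t0)// ltW.
pose N m := [set w | B t w <> B (u m) w].
have mN m : measurable (N m).
  by apply: (measurable_neq U_open U_sep); exact: process_measurable_fun.
have mC n : measurable (\bigcap_m N (n + m)%N) by exact: bigcapT_measurable.
have [F1 F2 F3] := F_filt.
apply: (@negligibleS _ _ _ _ ([set w | ~ finite_jumps h (B^~ w)] `|`
  \bigcup_n \bigcap_m N (n + m)%N)).
  move=> w /= neq; have [fb|] := pselect (finite_jumps h (B^~ w)); last by left.
  have [n Hn] := regularized_dyadic t0 uP fb.
  by right; exists n => // m _ /=; rewrite /N/= Hn ?leq_addr.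
apply: negligibleU.
  by apply/negligibleP => //; apply: (F2 +oo%E (leey _)); exact: bad_Foo.
apply: negligible_bigcup => n; apply/negligibleP => //.
apply/eqP; rewrite eq_le measure_ge0 andbT; apply/lee_addgt0Pr => e e0.
rewrite add0e.
have [dl dl0 Hdl] := B_small e0.
have [m _ Hm] := near_infty_natSinv_lt (PosNum dl0).
apply: (@le_trans _ _ (P (N (n + m)%N))).
  by apply: le_measure; rewrite ?inE// => w; apply.
have [_ /andP[_ um]] := uP (n + m)%N.
apply: Hdl => //; first exact/ltW.
apply: ltW; apply: lt_trans um _; rewrite ltrD2l; apply: Hm.
exact: leq_addl.
Qed.

End Regularize.

(** * Integrals of bounded functions and a coupling estimate *)

Section BoundedIntegrals.
Context (R : realType) (E : ptopologicalType).

Lemma bounded_integrable d (T : measurableType d) (P : probability T R) (g : T -> R) (M : R) A :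
  measurable A -> measurable_fun setT g -> (forall x, `|g x| <= M) ->
  P.-integrable A (EFin \o g).
Proof.
move=> mA mg gM.
have PT : (P [set: T] < +oo)%E by rewrite probability_setT ltry.
apply: (@integrableS _ _ _ P setT) => //.
apply: measurable_bounded_integrable => //.
by apply/bounded_funP; exists M.
Qed.

Lemma kernel_apply_bound (k : R.-pker (borelType E) ~> (borelType E)) (f : E -> R) (M : R) x :
  measurable_fun [set: borelType E] f -> (forall x, `|f x| <= M) ->
  `|kernel_apply k f x| <= M.
Proof.
move=> mf fM.
have k1 : k x [set: borelType E] = 1%E by exact: prob_kernel.
have kfin : (k x [set: borelType E] < +oo)%E by rewrite k1 ltry.
have int (g : E -> R) : measurable_fun [set: borelType E] g -> (forall x, `|g x| <= M) ->
    (k x).-integrable setT (EFin \o g).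
  move=> mg gM; apply: measurable_bounded_integrable => //.
  by apply/bounded_funP; exists M.
have M0 : 0 <= M by exact: le_trans (fM x).
rewrite /kernel_apply (le_trans (le_normr_Rintegral _ (int _ mf fM)))//.
have -> : M = \int[k x]_y M.
  by rewrite Rintegral_cst// k1 mulr1.
apply: le_Rintegral => //.
- apply: int => [|y]; first exact: measurableT_comp.
  by rewrite normr_id.
- by apply: int => [|y]; rewrite ?ger0_norm.
Qed.

Lemma kernel_apply_measurable (k : R.-pker (borelType E) ~> (borelType E)) (f : E -> R) (M : R) :
  measurable_fun [set: borelType E] f -> (forall x, `|f x| <= M) ->
  measurable_fun [set: borelType E] (kernel_apply k f).
Proof.
move=> mf fM.
have k1 x : k x [set: borelType E] = 1%E by exact: prob_kernel.
have intf x : (k x).-integrable setT (EFin \o f).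
  apply: measurable_bounded_integrable => //; first by rewrite [ltLHS]k1 ltry.
  by apply/bounded_funP; exists M.
have intM x : (k x).-integrable setT (EFin \o cst M).
  apply: measurable_bounded_integrable => //; first by rewrite [ltLHS]k1 ltry.
  by apply/bounded_funP; exists `|M|.
(* Shifting [f] by its bound [M] gives the nonnegative integrand that
   [measurable_fun_integral_kernel] asks for. *)
have -> : kernel_apply k f = (fun x => fine (\int[k x]_y (f y + M)%:E)%E - M).
  apply/funext => x; rewrite -/(Rintegral _ _ _) RintegralD//.
  by rewrite Rintegral_cst// k1 mulr1 addrK.
apply: measurable_funB => //; apply: measurableT_comp => //.
apply: measurable_fun_integral_kernel => //.
- by move=> U mU; exact: measurable_kernel.
- by move=> y; rewrite lee_fin -lerBlDr sub0r; have := fM y; rewrite ler_norml => /andP[].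
- by apply/measurable_EFinP; exact: measurable_funD.
Qed.

Context d (Omega : measurableType d) (P : probability Omega R).

(** The integrands differ only where [Y <> Z], and there by at most [2 M]. *)
Lemma Rintegral_coupling (Y Z : Omega -> borelType E) (g : E -> R) (M e : R) A :
  measurable A -> measurable_fun setT Y -> measurable_fun setT Z ->
  measurable [set w | (Y w : E) <> Z w] ->
  measurable_fun [set: borelType E] g -> (forall x, `|g x| <= M) ->
  (P [set w | (Y w : E) <> Z w] <= e%:E)%E ->
  `|\int[P]_(w in A) g (Y w) - \int[P]_(w in A) g (Z w)| <= 2 * M * e.
Proof.
move=> mA mY mZ mN mg gM PN.
have M0 : 0 <= M by exact: le_trans (gM point).
have mgY : measurable_fun setT (g \o Y) by exact: measurableT_comp.
have mgZ : measurable_fun setT (g \o Z) by exact: measurableT_comp.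
have iY : P.-integrable A (EFin \o (g \o Y)).
  exact: (@bounded_integrable _ _ P (g \o Y) M A mA mgY (fun x => gM (Y x))).
have iZ : P.-integrable A (EFin \o (g \o Z)).
  exact: (@bounded_integrable _ _ P (g \o Z) M A mA mgZ (fun x => gM (Z x))).
rewrite -RintegralB// -lee_fin EFin_normr_Rintegral//; last first.
  exact: (integrableB mA iY iZ).
apply: (le_trans (le_abse_integral _ _ _)) => //.
  by apply/measurable_EFinP/measurable_funTS; exact: measurable_funB.
set N := [set w | _] in mN PN.
apply: (@le_trans _ _ (\int[P]_(w in A) ((2 * M)%:E * (\1_N w)%:E))%E).
  apply: ge0_le_integral => //.
  - apply/measurable_EFinP; apply: measurable_funTS; apply: measurableT_comp => //.
    exact: measurable_funB.
  - by apply: measurable_funeM; apply/measurable_EFinP; exact: measurable_indic.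
  move=> w _; rewrite -EFinM lee_fin indicE.
  have [->|YZ] := pselect (Y w = Z w :> E).
    by rewrite subrr normr0 !mulr_ge0.
  rewrite mem_set// mulr1 (le_trans (ler_normB _ _))// mulrDl mul1r.
  by rewrite lerD.
rewrite ge0_integralZl//; last 2 first.
- by apply/measurable_EFinP; exact: measurable_indic.
- by rewrite lee_fin mulr_ge0.
rewrite integral_indic// [leRHS]EFinM lee_pmul//.
- by rewrite lee_fin mulr_ge0.
- apply: le_trans PN; apply: le_measure; rewrite ?inE//; exact: measurableI.
Qed.

End BoundedIntegrals.

(** * Completion of the right filtration by null sets *)

Section Augmentation.
Context (R : realType) d (Omega : measurableType d) (P : probability Omega R).
Context (F : \bar R -> set (set Omega)) (F_filt : filtration F).

Lemma right_filtration_sigma_algebra t : 0 <= t -> sigma_algebra setT (right_filtration F t).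
Proof.
move=> t0; have [F1 _ _] := F_filt.
apply: sigma_algebra_bigcap => s /= ts; apply: F1.
by rewrite (le_trans _ (ltW ts))// lee_fin.
Qed.

(** The sets that agree with a member of [right_filtration F t] off a null set form a sigma-algebra
    and include both kinds of generators. *)
Lemma augmented_filtration_ae t A : 0 <= t -> augmented_filtration P F t A ->
  exists A0 N, [/\ right_filtration F t A0, measurable N, P N = 0%E &
    forall w, ~ N w -> (A w <-> A0 w)].
Proof.
move=> t0; have [F1 F2 F3] := F_filt.
have [R0 RC RU] := right_filtration_sigma_algebra t0.
move: A; apply: smallest_sub; last first.
  move=> A [RA|[FA PA]]; first by exists A, set0; split=> //; exact: measure0.
  by exists set0, A; split => //; exact: (F2 +oo%E (leey _)).
split.
- by exists set0, set0; split=> //; exact: measure0.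
- move=> A [A0 [N [RA0 mN PN AN]]]; exists (setT `\` A0), N; split=> //; first exact: RC.
  by move=> w /AN [H1 H2]; split=> -[_ H]; split=> // ?; apply: H; [exact: H2|exact: H1].
- move=> A /choice[A0 /choice[N AN]].
  exists (\bigcup_n A0 n), (\bigcup_n N n); split.
  + by apply: RU => n; have [] := AN n.
  + by apply: bigcupT_measurable => n; have [] := AN n.
  + apply/negligibleP; first by apply: bigcupT_measurable => n; have [] := AN n.
    by apply: negligible_bigcup => n; apply/negligibleP; have [] := AN n.
  + move=> w nN; split=> -[n _ H]; exists n => //; have [_ _ _ /(_ w) AnN] := AN n.
      by apply/AnN => // Nw; apply: nN; exists n.
    by apply/AnN => // Nw; apply: nN; exists n.
Qed.

Lemma Rintegral_ae_set (g : Omega -> R) (M : R) A A0 N :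
  measurable A -> measurable A0 -> measurable N -> P N = 0%E ->
  (forall w, ~ N w -> (A w <-> A0 w)) ->
  measurable_fun setT g -> (forall x, `|g x| <= M) ->
  (\int[P]_(w in A) (g w)%:E = \int[P]_(w in A0) (g w)%:E)%E.
Proof.
move=> mA mA0 mN PN AN mg gM.
have ig D : measurable D -> P.-integrable D (EFin \o g).
  by move=> mD; apply: (@bounded_integrable R _ _ P g M D).
rewrite (negligible_integral mN mA (ig _ mA) PN).
rewrite (negligible_integral mN mA0 (ig _ mA0) PN); congr integral.
by apply/seteqP; split=> w [Aw nN]; split=> //; apply/AN.
Qed.

End Augmentation.

(** * The Markov property for the augmented filtration *)

Section AugmentedMarkov.
Context (R : realType) (E : ptopologicalType) (U : nat -> set E).
Context (U_open : forall i, open (U i)).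
Context (U_sep : forall x y, x <> y -> exists2 i, U i x & ~ U i y).
Context d (Omega : measurableType d) (P : probability Omega R).
Context (F : \bar R -> set (set Omega)) (F_filt : filtration F).
Context (Q : R -> R.-pker (borelType E) ~> (borelType E)).
Context (B : R -> Omega -> E) (B_markov : markov_process P Q (fun t => F t%:E) B).
Context (B_small : forall e, 0 < e -> exists2 dl, 0 < dl &
  forall s t, 0 <= s -> s <= t -> t <= s + dl -> (P [set w | B s w <> B t w] <= e%:E)%E).

(** [A] lies in [F r] for every [r > s], so the Markov property at time [r] applies on [A].
    Replacing [r] by [s] on both sides costs two coupling errors, which vanish as [r] decreases to
    [s]. *)
Lemma markov_right_filtration (s t : R) (f : E -> R) (M : R) A : 0 <= s -> 0 <= t ->
  measurable_fun [set: borelType E] f -> (forall x, `|f x| <= M) ->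
  right_filtration F s A ->
  \int[P]_(w in A) kernel_apply (Q t) f (B s w) = \int[P]_(w in A) f (B (s + t) w).
Proof.
move=> s0 t0 mf fM RA; have [F1 F2 F3] := F_filt; have [adB mkB] := B_markov.
have mA : measurable A by apply: (F2 +oo%E (leey _)); apply: RA => /=; exact: ltry.
have mB := process_measurable_fun F_filt adB.
have mneq u v : 0 <= u -> 0 <= v -> measurable [set w | B u w <> B v w].
  by move=> u0 v0; apply: (measurable_neq U_open U_sep); exact: mB.
have M0 : 0 <= M by exact: le_trans (fM point).
have C0 : 0 < 4 * (M + 1) by rewrite mulr_gt0// ltr_wpDl.
apply/eqP; rewrite -subr_eq0 -normr_le0; apply/ler_addgt0Pr => e e0; rewrite add0r.
have [dl dl0 Hdl] := B_small (divr_gt0 e0 C0).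
(* Two coupling errors of [2 M c] each must fit into [e = 4 (M + 1) c]; the added 1 keeps the
   divisor positive when [M = 0]. *)
set c := e / _ in Hdl.
pose r := s + dl.
have r0 : 0 <= r by rewrite addr_ge0// ltW.
have bf : bounded_fun f by apply/bounded_funP; exists M.
have [_ [_ _ /(_ A)]] := mkB r t f r0 t0 mf bf.
have FA : F r%:E A by apply: RA; rewrite /= lte_fin ltrDl.
move=> /(_ FA)/(congr1 fine) Hr.
have mk := kernel_apply_measurable (Q t) mf fM.
have kM (x : E) := kernel_apply_bound (Q t) x mf fM.
have st0 : 0 <= s + t by rewrite addr_ge0.
have rt0 : 0 <= r + t by rewrite addr_ge0.
have sr : s <= r by rewrite lerDl ltW.
have H1 := Rintegral_coupling mA (mB _ s0) (mB _ r0) (mneq _ _ s0 r0) mk kM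
  (Hdl _ _ s0 sr (lexx _)).
have P2 : (P [set w | B (s + t)%R w <> B (r + t)%R w] <= c%:E)%E.
  by apply: Hdl; rewrite ?lerD2r// addrAC.
have {P2}H2 := Rintegral_coupling mA (mB _ st0) (mB _ rt0) (mneq _ _ st0 rt0) mf fM P2.
have c0 : 0 <= c by rewrite ltW// divr_gt0.
have cE : c * (4 * (M + 1)) = e by rewrite /c divfK// gt_eqF.
have ce : 2 * M * c + 2 * M * c <= e by lra.
apply: le_trans ce; rewrite -(subrKA (\int[P]_(w in A) kernel_apply (Q t) f (B r w))).
rewrite (le_trans (ler_normD _ _))// lerD//.
by rewrite [X in `|X - _|]Hr distrC.
Qed.

Context (B' : R -> Omega -> E) (B'_modif : modification P B B')
  (B'_adapted : adapted (augmented_filtration P F) B').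

(** The coupling bound with error 0, as [B' u] and [B u] differ only within a null set. *)
Lemma modification_Rintegral (u : R) (g : E -> R) (M : R) A : 0 <= u -> measurable A ->
  measurable_fun [set: borelType E] g -> (forall x, `|g x| <= M) ->
  \int[P]_(w in A) g (B' u w) = \int[P]_(w in A) g (B u w).
Proof.
move=> u0 mA mg gM.
have [mB' [N [mN PN HN]]] := B'_modif u0.
have mB := process_measurable_fun F_filt B_markov.1 u0.
have mneq : measurable [set w | B' u w <> B u w].
  exact: (measurable_neq U_open U_sep mB' mB).
apply/eqP; rewrite -subr_eq0 -normr_le0.
rewrite (le_trans (Rintegral_coupling (e := 0) mA mB' mB mneq mg gM _)) ?mulr0//.
apply: (@le_trans _ _ (P N)); last by rewrite PN.
by apply: le_measure; rewrite ?inE// => w /= H; apply: HN => /= /esym.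
Qed.

(** The integral identity is proved for events of the augmented filtration; adaptedness puts the
    events generated by [B' s] among them, which settles the other conditional expectation. *)
Lemma augmented_markov : markov_process P Q (augmented_filtration P F) B'.
Proof.
split=> // s t f s0 t0 mf /bounded_funP[M fM]; have [F1 F2 F3] := F_filt.
have mk := kernel_apply_measurable (Q t) mf fM.
have kM (x : E) := kernel_apply_bound (Q t) x mf fM.
have st0 : 0 <= s + t by rewrite addr_ge0.
have [mBs _] := B'_modif s0.
have [mBst _] := B'_modif st0.
have mkB : measurable_fun setT (kernel_apply (Q t) f \o B' s) by exact: measurableT_comp mk mBs.
have mfB : measurable_fun setT (f \o B' (s + t)) by exact: measurableT_comp mf mBst.
have int A : measurable A -> P.-integrable A (EFin \o (kernel_apply (Q t) f \o B' s)).
  move=> mA; exact: (@bounded_integrable R _ _ P (kernel_apply (Q t) f \o B' s) M A mA mkB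
    (fun w => kM (B' s w))).
have intf A : measurable A -> P.-integrable A (EFin \o (f \o B' (s + t))).
  move=> mA; exact: (@bounded_integrable R _ _ P (f \o B' (s + t)) M A mA mfB
    (fun w => fM (B' (s + t) w))).
have sub : preimage_set_system setT (kernel_apply (Q t) f \o B' s) measurable
    `<=` sigma_gen (B' s).
  move=> _ [C mC <-]; exists (kernel_apply (Q t) f @^-1` C).
    exact: measurable_fun_preimage mk mC.
  by rewrite !setTI comp_preimage.
have id A : augmented_filtration P F s A ->
    (\int[P]_(w in A) ((kernel_apply (Q t) f \o B' s) w)%:E =
     \int[P]_(w in A) ((f \o B' (s + t)%R) w)%:E)%E.
  move=> aA; have mA : measurable A by exact: (augmented_measurable F_filt aA).
  have [A0 [N [RA0 mN PN AN]]] := augmented_filtration_ae F_filt s0 aA.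
  have mA0 : measurable A0 by apply: (F2 +oo%E (leey _)); apply: RA0 => /=; exact: ltry.
  (* [A] is first traded for the almost equal [A0] of the right filtration, then [B'] for [B], for
     which the identity is known. *)
  rewrite (Rintegral_ae_set mA mA0 mN PN AN mkB (fun w => kM (B' s w))).
  rewrite (Rintegral_ae_set mA mA0 mN PN AN mfB (fun w => fM (B' (s + t) w))).
  rewrite -[LHS]fineK; last exact: (integrable_fin_num mA0 (int _ mA0)).
  rewrite -[RHS]fineK; last exact: (integrable_fin_num mA0 (intf _ mA0)).
  congr EFin.
  have e1 := modification_Rintegral s0 mA0 mk kM.
  have e2 := modification_Rintegral st0 mA0 mf fM.
  have e3 := markov_right_filtration s0 t0 mf fM RA0.
  exact: etrans (etrans e1 e3) (esym e2).
split; split.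
- exact: sub.
- exact: int.
- by move=> A /(B'_adapted s0); exact: id.
- exact: subset_trans sub (B'_adapted s0).
- exact: int.
- exact: id.
Qed.

End AugmentedMarkov.

(** * From operator norm continuity to the càdlàg modification *)

Lemma opnorm_continuous_small (R : realType) (E : ptopologicalType)
    (Q : R -> R.-pker (borelType E) ~> (borelType E)) :
  opnorm_continuous Q -> forall e, 0 < e -> exists2 dl, 0 < dl &
    forall s, 0 <= s -> s <= dl ->
      (opnorm (fun f => kernel_apply (Q s) f \- kernel_apply (Q 0) f)%R <= e%:E)%E.
Proof.
move=> /(_ 0 (lexx _)) H e e0.
have /H : nbhs (0%E : \bar R) [set y | (y < e%:E)%E].
  by apply: open_nbhs_nbhs; split; [exact: open_ereal_lt_ereal|rewrite /= lte_fin].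
rewrite /= nbhs_simpl/= => /nbhs_ballP[r /= r0 Hr].
exists (r / 2); first by rewrite divr_gt0.
move=> s s0 sr; apply: ltW; apply: Hr; last by rewrite /= in_itv/= s0.
rewrite /ball/= sub0r normrN ger0_norm// (le_lt_trans sr)//.
by rewrite ltr_pdivrMr// ltr_pMr// ltr1n.
Qed.

Theorem proposition1p12 (R : realType) (E : ptopologicalType)
    (d : measure_display) (Omega : measurableType d) (P : probability Omega R)
    (F : \bar R -> set (set Omega))
    (Q : R -> R.-pker (borelType E) ~> (borelType E))
    (B : R -> Omega -> E) :
  metrizable R E ->
  locally_compact [set: E] ->
  sigma_compact E ->
  filtration F ->
  feller_semigroup Q ->
  opnorm_continuous Q ->
  markov_process P Q (fun t => F t%:E) B ->
  exists B' : R -> Omega -> E,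
    [/\ modification P B B',
        cadlag B',
        adapted (augmented_filtration P F) B' &
        markov_process P Q (augmented_filtration P F) B'].
Proof.
move=> [m [m_ge0 m_eq0 m_sym m_tri m_nbhs]] _ sE F_filt [QS _] Qc BM.
have [U [U_open U_sep]] :=
  metric_countable_separating m_ge0 m_eq0 m_sym m_tri m_nbhs sE.
have m1 := metric_measurable_set1 m_ge0 m_eq0 m_tri m_nbhs.
have Qdiag e : 0 < e -> exists2 dl, 0 < dl &
    forall s x, 0 <= s <= dl -> ((1 - e)%:E <= Q s x [set x])%E.
  move=> /(opnorm_continuous_small Qc)[dl dl0 Hdl]; exists dl => // s x /andP[s0 sdl].
  have [Q0 _ _] := QS.
  exact: (opnorm_diag m_ge0 m_eq0 m_sym m_tri m_nbhs Q0 (Hdl s s0 sdl)).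
have F2 t : 0 <= t -> F t%:E `<=` measurable.
  by move=> t0; have [_ F2 _] := F_filt; apply: F2; rewrite lee_fin.
(* Stochastic continuity, uniform in time: it makes the right values a modification and carries the
   Markov property over to [right_filtration]. *)
have B_small e : 0 < e -> exists2 dl, 0 < dl &
    forall s t, 0 <= s -> s <= t -> t <= s + dl ->
      (P [set w | B s w <> B t w] <= e%:E)%E.
  move=> /Qdiag[dl dl0 Hdl]; exists dl => // s t s0 st tdl.
  rewrite -(subrKC s t); apply: (markov_jump_prob U_open U_sep m1 BM F2) => //.
    by rewrite subr_ge0.
  by move=> x; apply: Hdl; rewrite subr_ge0 st lerBlDl.
(* 1/4 is the constant of the first-exit bound: up to time [h] every state is kept with probability
   at least 3/4. *)
have q0 : 0 < (4^-1 : R) by rewrite invr_gt0.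
have [h h0 Hh] := Qdiag _ q0.
have mB := process_measurable_fun F_filt BM.1.
have bad_null : P [set w | ~ finite_jumps h (B^~ w)] = 0%E.
  apply: (infinite_jumps_null U_open U_sep h0 mB) => n k.
  (* A grid step has length [h / N] with [N = 2 ^ n], so the linear bound gives a jump probability
     of at most [1 / (2 * 2 ^ n)]. *)
  have gS : grid h n k.+1 = grid h n k + h / (2 ^ n)%:R.
    by rewrite /grid -natr1 mulrDr mulr1 mulrDl natrX.
  rewrite /jump_set gS; apply: (markov_jump_prob U_open U_sep m1 BM F2).
  - exact: grid_ge0.
  - by rewrite divr_ge0// ltW.
  - move=> x; apply: (diag_linear_bound m1 h0 QS) => //.
    by rewrite expn_gt0.
have modif := regularized_modification h0 F_filt BM.1 U_open U_sep bad_null B_small.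
have adap := regularized_adapted h0 F_filt BM.1 U_open U_sep bad_null.
exists (regularized h B); split; first exact: modif.
- exact: (regularized_cadlag h0 B).
- exact: adap.
- exact: (augmented_markov U_open U_sep F_filt BM B_small modif adap).
Qed.
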